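(* For all integers $T,p,R\ge1$, \[ \gamma_2(\mathcal S^{Tp-1},\|\cdot\|_\ominus)\lesssim\sqrt{T\tilde p},\qquad\text{where }\tilde p:=p\min\{T,\log^2(eTp)\log^2(eT)\}, \] with $\mathcal S^{Tp-1}$ the unit Euclidean sphere of $\mathbb R^{Tp}$.
   Context: For $\bar v=[v_1^\top,\dots,v_T^\top]^\top\in\mathbb R^{Tp}$ ($v_i\in\mathbb R^p$) and $R\ge1$, let $\mathsf{Toep}_T(\bar v)$ be the $R\times(R+T-1)$ block matrix with $1\times p$ blocks whose $i$-th block row has $v_T^\top,v_{T-1}^\top,\dots,v_1^\top$ in block columns $i,i+1,\dots,i+T-1$ and zeros elsewhere (so the $k$-th block superdiagonal equals $v_{T-k}^\top$, $0\le k\le T-1$). Define the norm $\|\bar v\|_\ominus:=\|\mathsf{Toep}_T(\bar v)\|_{\mathrm{op}}$. Talagrand's functional: $\gamma_2(\mathcal X,\mathsf d):=\inf_{(\mathcal A_n)}\sup_{x\in\mathcal X}\sum_{n\ge0}2^{n/2}\mathsf{diam}(\mathcal A_n(x))$ over partition sequences with $|\mathcal A_0|=1$, $|\mathcal A_n|\le2^{2^n}$. $\lesssim$ hides a universal constant. *)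

(* Defs.v *)
From HB Require Import structures.
From mathcomp Require Import all_boot all_order all_algebra.
From mathcomp Require Import all_classical all_reals all_analysis.
Set Implicit Arguments. Unset Strict Implicit. Unset Printing Implicit Defensive.
Import Order.TTheory GRing.Theory Num.Theory.
Local Open Scope classical_set_scope.
Local Open Scope ring_scope.

Section Defs.
Variable R : realType.

Definition enorm n (x : 'rV[R]_n) : R := Num.sqrt (\sum_i x 0 i ^+ 2).

Definition opnorm m n (A : 'M[R]_(m, n)) : R :=
  sup [set enorm (A *m x)^T | x in [set x : 'cV[R]_n | enorm x^T <= 1]].

(* k-th coordinate (0-indexed) of a vector, 0 out of range. *)
Definition vat n (v : 'rV[R]_n) (k : nat) : R :=
  odflt 0 (omap (fun i : 'I_n => v 0 i) (insub k)).

(* vbar = [v_1^T, ..., v_T^T]^T in R^{Tp}: coordinate j (0-indexed) of block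
   v_m (1-indexed) is coordinate (m-1)*p + j of vbar.
   Toep_T(vbar) is the nR x (nR+T-1) block matrix with 1 x p blocks whose
   i-th block row carries v_T, ..., v_1 in block columns i, ..., i+T-1;
   as a real matrix it is nR x ((nR+T-1)*p); column k lies in block column
   k %/ p, coordinate k %% p.  All indices below are 0-indexed: block (i,c)
   is v_{T-(c-i)} when i <= c < i+T, i.e. the block at offset (T-1-(c-i))*p. *)
Definition Toep (T p nR : nat) (v : 'rV[R]_(T * p)) : 'M[R]_(nR, (nR + T - 1) * p) :=
  \matrix_(i < nR, k < (nR + T - 1) * p)
    let c := (k %/ p)%N in let j := (k %% p)%N in
    if ((i <= c) && (c < i + T))%N then vat v ((T - 1 - (c - i)) * p + j)%N
    else 0.

Definition toepnorm (T p nR : nat) (v : 'rV[R]_(T * p)) : R := opnorm (Toep nR v).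

Definition sphere n : set 'rV[R]_n := [set x | enorm x = 1].

Section Gamma2.
Variables (V : Type) (d : V -> V -> R).

Definition is_partition (X : set V) (P : set (set V)) : Prop :=
  [/\ forall C, P C -> C !=set0 /\ C `<=` X,
      forall C D, P C -> P D -> C `&` D !=set0 -> C = D
    & forall x, X x -> exists2 C, P C & C x].

(* A(x): the (unique) cell of the partition P containing x. *)
Definition cell (P : set (set V)) (x : V) : set V :=
  \bigcup_(C in [set C | P C /\ C x]) C.

Definition diam (A : set V) : \bar R :=
  ereal_sup [set (d x y)%:E | x in A & y in A].

Definition admissible (X : set V) (A : nat -> set (set V)) : Prop :=
  (forall n, is_partition X (A n)) /\
  (A 0%N #<= `I_1)%card /\ (forall n, (A n #<= `I_(2 ^ (2 ^ n)))%card).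

Definition gamma2 (X : set V) : \bar R :=
  ereal_inf [set ereal_sup
     [set (\sum_(0 <= n <oo) ((Num.sqrt (2 ^+ n : R))%:E * diam (cell (A n) x)))%E
        | x in X]
   | A in [set A | admissible X A]].
End Gamma2.

Definition ptilde (T p : nat) : R :=
  p%:R * Num.min (T%:R)
    (ln (expR 1 * (T * p)%:R) ^+ 2 * ln (expR 1 * T%:R) ^+ 2).

End Defs.

(* Main.v *)
Require Import Defs.
From mathcomp Require Import all_boot all_order all_algebra.
From mathcomp Require Import all_classical all_reals all_analysis.
From mathcomp Require Import ring lra zify.
Set Implicit Arguments. Unset Strict Implicit. Unset Printing Implicit Defensive.
Import Order.TTheory GRing.Theory Num.Theory.
Local Open Scope classical_set_scope.
Local Open Scope ring_scope.

(* Write d = T * p. The partitions of an admissible sequence need not be nested,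
   so it suffices to find, for each n, a code with at most 2^(2^n) values such
   that points of the sphere with equal codes are close. Three codes are used.
   - The constant code: the norm is at most sqrt T times the Euclidean one.
   - Coordinatewise truncation to a grid. Writing the grid coordinates in unary
     costs O(2^n) bits and gives diameter O(sqrt T * d / 2^n) once 2^n >= 4 d.
   - A greedy code. Cutting the rows into groups of length T and applying a
     discrete Fourier transform of size 2 T shows that the norm is at most
     3 sqrt p times the maximum of 4 T p linear functionals of Euclidean norm at
     most sqrt T. As long as one of them exceeds e on the residual, subtracting
     a multiple of it lowers the squared residual by e^2 / T, so T / e^2 steps,
     each recorded by O(log(e T p)) bits, bring all functionals below e. This
     gives diameter O(sqrt (d log(e d) / 2^n)).
   The first two codes alone give T sqrt p. Using the greedy code in the range
   4 p <= 2^n <= 4 d T, which contains O(log (e T)) values of n, gives the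
   bound with logarithms. *)

Section Codes.
Variables (R : numDomainType) (V : Type) (d : V -> V -> R).
Implicit Types (X : set V) (N : nat) (D : R).

Definition coded X N D : Prop :=
  exists c : V -> nat, (forall x, X x -> (c x < N)%N) /\
    (forall x y, X x -> X y -> c x = c y -> d x y <= D).

Lemma coded_le X N N' D D' :
  (N <= N')%N -> D <= D' -> coded X N D -> coded X N' D'.
Proof.
move=> leN leD [c [cN cD]]; exists c; split=> [x /cN|x y Xx Xy cxy].
  by move=> /leq_trans; apply.
exact: le_trans (cD _ _ Xx Xy cxy) leD.
Qed.

Lemma coded_const X N D : (0 < N)%N ->
  (forall x y, X x -> X y -> d x y <= D) -> coded X N D.
Proof.
by move=> N0 dD; exists (fun=> 0%N); split=> // x y Xx Xy _; exact: dD.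
Qed.

Lemma coded_finset X (K : finType) (S : {set K}) (c : V -> K) D :
  (forall x, X x -> c x \in S) ->
  (forall x y, X x -> X y -> c x = c y -> d x y <= D) ->
  coded X #|S| D.
Proof.
move=> cS cD; exists (fun x => index (c x) (enum S)).
split=> [x Xx|x y Xx Xy cxy].
  by rewrite cardE index_mem mem_enum cS.
apply: cD => //; rewrite -[LHS](nth_index (c x) (s := enum S)) ?mem_enum ?cS//.
by rewrite cxy nth_index// mem_enum cS.
Qed.

End Codes.

Section Gamma2.
Variables (R : realType) (V : Type) (d : V -> V -> R).
Implicit Types (X : set V) (N : nat).

Definition fibers X (c : V -> nat) : set (set V) :=
  [set C | exists2 x, X x & C = [set y | X y /\ c y = c x]].

Lemma fibers_partition X c : is_partition X (fibers X c).
Proof.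
split.
- by move=> _ [x Xx ->]; split=> [|y []//]; exists x.
- move=> _ _ [x Xx ->] [y Xy ->] [z [[_ zx] [_ zy]]].
  by apply/seteqP; split=> t [Xt ct]; split=> //; rewrite ct -?zx -?zy.
- by move=> x Xx; exists [set y | X y /\ c y = c x] => //; exists x.
Qed.

Lemma card_fibers X c N : (forall x, X x -> (c x < N)%N) ->
  (fibers X c #<= `I_N)%card.
Proof.
move=> cN.
apply: card_le_trans (card_image_le (fun k => [set y | X y /\ c y = k]) `I_N).
by apply: subset_card_le => _ [x Xx ->]; exists (c x) => //=; exact: cN.
Qed.

Lemma cell_fibers X c x : X x ->
  cell (fibers X c) x = [set y | X y /\ c y = c x].
Proof.
move=> Xx; apply/seteqP; split=> [y [_ [[z Xz ->] [_ cx]] [Xy cy]]|y Xcy].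
  by split=> //; rewrite cy cx.
by exists [set y | X y /\ c y = c x] => //; split=> //; exists x.
Qed.

Lemma gamma2_le_coded X (D : nat -> R) (B : R) : (forall x, d x x = 0) ->
  coded d X 1 (D 0%N) ->
  (forall n, (0 < n)%N -> coded d X (2 ^ (2 ^ n)) (D n)) ->
  (\forall N \near \oo, \sum_(0 <= n < N) Num.sqrt (2 ^+ n) * D n <= B) ->
  (gamma2 d X <= B%:E)%E.
Proof.
move=> d0 codes0 codesS sumB.
pose size n := if n is 0%N then 1%N else (2 ^ (2 ^ n))%N.
have /choice[c cP] : forall n, exists c : V -> nat,
    (forall x, X x -> (c x < size n)%N) /\
    (forall x y, X x -> X y -> c x = c y -> d x y <= D n).
  by case=> [|n]; [exact: codes0|exact: codesS].
have adm : admissible X (fun n => fibers X (c n)).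
  split; [|split] => [n||n]; first exact: fibers_partition.
    by apply: card_fibers; exact: (cP 0%N).1.
  apply: card_fibers => x /(cP n).1 /leq_trans; apply.
  by case: n => //= n; rewrite expn_gt0.
apply: le_trans (ereal_inf_lbound _) _.
  by exists (fun n => fibers X (c n)).
apply: ge_ereal_sup => _ [x Xx <-].
have diam_ge0 n : (0 <= diam d (cell (fibers X (c n)) x))%E.
  rewrite cell_fibers//; apply: ereal_sup_ubound.
  by exists x => //; exists x => //; rewrite d0.
have diam_le n : (diam d (cell (fibers X (c n)) x) <= (D n)%:E)%E.
  rewrite cell_fibers//; apply: ge_ereal_sup => _ [y [Xy cy] [z [Xz cz] <-]].
  by rewrite lee_fin; apply: (cP n).2 => //; rewrite cy cz.
apply: lime_le.
  by apply: is_cvg_nneseries => n _ _; rewrite mule_ge0// lee_fin sqrtr_ge0.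
near=> N.
apply: (@le_trans _ _ (\sum_(0 <= n < N) (Num.sqrt (2 ^+ n) * D n)%:E)%E).
  by apply: lee_sum => n _; rewrite EFinM lee_wpmul2l// lee_fin sqrtr_ge0.
by rewrite sumEFin lee_fin; near: N.
Unshelve. all: by end_near. Qed.

End Gamma2.

Section ThreeRanges.
Variable R : realType.
Local Notation sqrt2 := (Num.sqrt (2 : R)).

Lemma sqrt2_gt0 : 0 < sqrt2.
Proof. by rewrite sqrtr_gt0. Qed.

Lemma sqrt2_bounds : 4 / 3 <= sqrt2 <= 3 / 2.
Proof.
have sqrt2E : sqrt2 ^+ 2 = 2 by rewrite sqr_sqrtr.
by have sqrt2_pos := sqrt2_gt0; apply/andP; split; nra.
Qed.

Lemma sqrt2X_gt0 n : 0 < sqrt2 ^+ n.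
Proof. exact: exprn_gt0 sqrt2_gt0. Qed.

Lemma sqr_sqrt2X n : (sqrt2 ^+ n) ^+ 2 = 2 ^+ n.
Proof. by rewrite exprAC sqr_sqrtr. Qed.

Lemma sqrtr_pow2 n : Num.sqrt (2 ^+ n) = sqrt2 ^+ n.
Proof. by rewrite -sqr_sqrt2X sqrtr_sqr ger0_norm// ltW// sqrt2X_gt0. Qed.

Lemma sum_sqrt2X_le N : \sum_(0 <= n < N) sqrt2 ^+ n <= 4 * sqrt2 ^+ N.
Proof.
elim: N => [|N IH]; first by rewrite big_geq// mulr_ge0.
rewrite big_nat_recr//= exprS.
by have /andP[+ _] := sqrt2_bounds; have := sqrt2X_gt0 N; nra.
Qed.

Lemma sum_sqrt2XV_le m N : \sum_(m <= n < N) (sqrt2 ^+ n)^-1 <= 4 / sqrt2 ^+ m.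
Proof.
have sqrt2V_le : sqrt2^-1 <= 3 / 4.
  have /andP[sqrt2_ge _] := sqrt2_bounds.
  by rewrite -[3 / 4]invf_div lef_pV2 ?posrE ?sqrt2_gt0//; lra.
have sqrt2V_gt0 : 0 < sqrt2^-1 by rewrite invr_gt0 sqrt2_gt0.
have -> : \sum_(m <= n < N) (sqrt2 ^+ n)^-1 =
    series (geometric (sqrt2 ^+ m)^-1 sqrt2^-1) (N - m)%N.
  rewrite -{1}[m]add0n big_addn; apply: eq_bigr => n _ /=.
  by rewrite exprD invfM mulrC exprVn.
have sqrt2XV_gt0 : 0 < (sqrt2 ^+ m)^-1 by rewrite invr_gt0 sqrt2X_gt0.
apply: (@le_trans _ _ ((sqrt2 ^+ m)^-1 / (1 - sqrt2^-1))).
  by apply: geometric_le_lim; rewrite ?(ltW sqrt2XV_gt0)// gtr0_norm//; lra.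
by rewrite mulrC ler_pM2r// -[4]invrK lef_pV2 ?posrE//; lra.
Qed.

(* Only the two extreme ranges contribute geometric series, so each is dominated
   by its end facing the middle range, where every level contributes Q. *)
Lemma gamma2_le_three_ranges (V : Type) (d : V -> V -> R) (X : set V)
    (n0 n1 : nat) (U Q W : R) : (forall x, d x x = 0) ->
  (0 < n0 <= n1)%N -> 0 <= U -> 0 <= W ->
  (forall x y, X x -> X y -> d x y <= U) ->
  (forall n, (n0 <= n < n1)%N -> coded d X (2 ^ (2 ^ n)) (Q / sqrt2 ^+ n)) ->
  (forall n, (n1 <= n)%N -> coded d X (2 ^ (2 ^ n)) (W / 2 ^+ n)) ->
  (gamma2 d X <=
    (4 * U * sqrt2 ^+ n0 + (n1 - n0)%:R * Q + 4 * W / sqrt2 ^+ n1)%:E)%E.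
Proof.
move=> d0 /andP[n0_gt0 n01] U0 W0 dU dQ dW.
pose D n :=
  if (n < n0)%N then U else if (n < n1)%N then Q / sqrt2 ^+ n else W / 2 ^+ n.
apply: (@gamma2_le_coded _ _ _ _ D) => //.
- by apply: coded_const => //; rewrite /D n0_gt0.
- move=> n n_gt0; rewrite /D; case: (ltnP n n0) => [_|n0n].
    by apply: coded_const => //; rewrite expn_gt0.
  by case: (ltnP n n1) => nn1; [apply: dQ; rewrite n0n|exact: dW].
near=> N; have n1N : (n1 <= N)%N by near: N; exact: nbhs_infty_ge.
under eq_bigr do rewrite sqrtr_pow2.
rewrite (@big_cat_nat _ _ _ n1)//= (@big_cat_nat _ _ _ n0)//=.
apply: lerD; first apply: lerD.
- rewrite (eq_big_nat _ _ (F2 := fun n => U * sqrt2 ^+ n)); last first.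
    by move=> n /andP[_ nn0]; rewrite /D nn0 mulrC.
  by rewrite -mulr_sumr [4 * U]mulrC -mulrA ler_wpM2l// sum_sqrt2X_le.
- rewrite (eq_big_nat _ _ (F2 := fun=> Q)) ?sumr_const_nat ?mulr_natl//.
  move=> n /andP[n0n nn1]; rewrite /D ltnNge n0n/= nn1.
  by rewrite mulrC divfK// gt_eqF// sqrt2X_gt0.
- rewrite (eq_big_nat _ _ (F2 := fun n => W * (sqrt2 ^+ n)^-1)); last first.
    move=> n /andP[n1n _]; rewrite /D !ltnNge (leq_trans n01 n1n) n1n/=.
    by rewrite -sqr_sqrt2X; field; rewrite gt_eqF// sqrt2X_gt0.
  by rewrite -mulr_sumr [4 * W]mulrC -mulrA ler_wpM2l// sum_sqrt2XV_le.
Unshelve. all: by end_near. Qed.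

End ThreeRanges.

(* The difference of the two sides is half the sum of the squares of the
   two by two minors (Lagrange's identity). *)
Lemma sum_mul_sqr_le (R : realDomainType) (I : finType) (a b : I -> R) :
  (\sum_i a i * b i) ^+ 2 <= (\sum_i a i ^+ 2) * (\sum_i b i ^+ 2).
Proof.
have minors_ge0 : 0 <= \sum_i \sum_j (a i * b j - a j * b i) ^+ 2.
  by apply: sumr_ge0 => i _; apply: sumr_ge0 => j _; exact: sqr_ge0.
suff : \sum_i \sum_j (a i * b j - a j * b i) ^+ 2 =
    2 * ((\sum_i a i ^+ 2) * (\sum_i b i ^+ 2) - (\sum_i a i * b i) ^+ 2).
  by lra.
transitivity (\sum_i \sum_j (a i ^+ 2 * b j ^+ 2 + a j ^+ 2 * b i ^+ 2 -
    2 * ((a i * b i) * (a j * b j)))).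
  by apply: eq_bigr => i _; apply: eq_bigr => j _; ring.
under eq_bigr do rewrite sumrB big_split/= -mulr_sumr -mulr_suml -!mulr_sumr.
by rewrite sumrB big_split/= -!mulr_suml -!mulr_sumr -mulr_suml; ring.
Qed.

Section DotProduct.
Variables (R : realDomainType) (n : nat).
Implicit Types x y z : 'rV[R]_n.

Definition dot x y : R := \sum_i x 0 i * y 0 i.

Lemma dotBr x y z : dot x (y - z) = dot x y - dot x z.
Proof. by rewrite -sumrB; apply: eq_bigr => i _; rewrite !mxE mulrBr. Qed.

Lemma dotZl (a : R) x y : dot (a *: x) y = a * dot x y.
Proof. by rewrite mulr_sumr; apply: eq_bigr => i _; rewrite !mxE mulrA. Qed.

Lemma dotZr (a : R) x y : dot x (a *: y) = a * dot x y.
Proof. by rewrite mulr_sumr; apply: eq_bigr => i _; rewrite !mxE mulrCA. Qed.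

Lemma dot_subZ x y (a : R) :
  dot (x - a *: y) (x - a *: y) = dot x x - 2 * a * dot y x + a ^+ 2 * dot y y.
Proof.
rewrite !mulr_sumr -sumrB -big_split/=; apply: eq_bigr => i _.
by rewrite !mxE; ring.
Qed.

Lemma dotxx_ge0 x : 0 <= dot x x.
Proof. by apply: sumr_ge0 => i _; rewrite -expr2 sqr_ge0. Qed.

Lemma dotxx_eq0 x : dot x x = 0 -> x = 0.
Proof.
move=> xx0; apply/rowP => i; rewrite mxE; apply/eqP; rewrite -sqrf_eq0 expr2.
by rewrite (psumr_eq0P _ xx0)// => j _; rewrite -expr2 sqr_ge0.
Qed.

End DotProduct.

Section EuclideanNorm.
Variables (R : realType) (n : nat).
Implicit Types x y : 'rV[R]_n.

Lemma enormE x : enorm x = Num.sqrt (dot x x).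
Proof. by []. Qed.

Lemma enorm_ge0 x : 0 <= enorm x.
Proof. exact: sqrtr_ge0. Qed.

Lemma sqr_enorm x : enorm x ^+ 2 = dot x x.
Proof. by rewrite enormE sqr_sqrtr// dotxx_ge0. Qed.

Lemma enorm0 : enorm (0 : 'rV[R]_n) = 0.
Proof. by rewrite /enorm big1 ?sqrtr0// => i _; rewrite mxE expr0n. Qed.

Lemma enorm_sub_le2 x y : enorm x = 1 -> enorm y = 1 -> enorm (x - y) <= 2.
Proof.
move=> x1 y1; rewrite -[2 in leRHS]ger0_norm// -sqrtr_sqr enormE ler_wsqrtr//.
have := dot_subZ x y 1; have := dot_subZ x y (- 1).
have := dotxx_ge0 (x - (- 1) *: y); rewrite scale1r -!sqr_enorm x1 y1; lra.
Qed.

Lemma enorm_le_coord x (delta : R) : (forall i, `|x 0 i| <= delta) ->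
  enorm x <= Num.sqrt n%:R * delta.
Proof.
case: n x => [x _|m x xdelta].
  by rewrite sqrtr0 mul0r /enorm big_ord0 sqrtr0.
have delta0 : 0 <= delta by exact: le_trans (xdelta 0).
rewrite -[delta]ger0_norm// -sqrtr_sqr -sqrtrM// ler_wsqrtr//.
rewrite mulr_natl -[m.+1 in leRHS]card_ord -sumr_const; apply: ler_sum => i _.
by rewrite -real_normK ?num_real// lerXn2r ?nnegrE.
Qed.

Lemma sum_norm_le x : \sum_i `|x 0 i| <= Num.sqrt n%:R * enorm x.
Proof.
rewrite -sqrtrM ?ler0n// -[leLHS]ger0_norm ?sumr_ge0// -sqrtr_sqr ler_wsqrtr//.
under eq_bigr do rewrite -[`|_|]mul1r.
apply: le_trans (sum_mul_sqr_le (fun=> 1) (fun i => `|x 0 i|)) _.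
rewrite /= expr1n sumr_const card_ord ler_wpM2l// ler_sum// => i _.
by rewrite real_normK ?num_real.
Qed.

End EuclideanNorm.

Section Greedy.
Variables (R : realFieldType) (n : nat).
Variables (I : finType) (f : I -> 'rV[R]_n) (L e : R).
Implicit Types (x y : 'rV[R]_n) (m : nat).
Hypotheses (L_gt0 : 0 < L) (e_gt0 : 0 < e).
Hypothesis fL : forall i, dot (f i) (f i) <= L.

Definition greedy_step (o : option (I * bool)) : 'rV[R]_n :=
  if o is Some (i, b) then ((-1) ^+ b * (e / L)) *: f i else 0.

Definition greedy_decode (s : seq (option (I * bool))) : 'rV[R]_n :=
  \sum_(o <- s) greedy_step o.

Lemma greedy_step_decrease x i
    (r := x - greedy_step (Some (i, dot (f i) x < 0))) :
  e < `|dot (f i) x| -> dot r r <= dot x x - e ^+ 2 / L.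
Proof.
move=> big; rewrite dot_subZ exprMn sqrr_sign mul1r.
rewrite -mulrA -[_ * (e / L) * _]mulrAC -normrEsign.
have eL_gt0 : 0 < e / L by rewrite divr_gt0.
have step_sqr : (e / L) ^+ 2 * dot (f i) (f i) <= e ^+ 2 / L.
  rewrite [leRHS](_ : _ = (e / L) ^+ 2 * L); last by field; rewrite gt_eqF.
  by rewrite ler_wpM2l// sqr_ge0.
have : e ^+ 2 / L <= `|dot (f i) x| * (e / L).
  by rewrite expr2 -mulrA ler_pM2r// ltW.
lra.
Qed.

Lemma greedy_approx m x : dot x x <= m%:R * (e ^+ 2 / L) ->
  exists s : m.-tuple (option (I * bool)),
    forall i, `|dot (f i) (x - greedy_decode s)| <= e.
Proof.
elim: m x => [|m IH] x xm.
  exists [tuple] => i; have /dotxx_eq0 -> : dot x x = 0.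
    by apply/eqP; rewrite eq_le dotxx_ge0 andbT; rewrite mul0r in xm.
  rewrite /greedy_decode big_nil subrr /dot big1 ?normr0 ?ltW// => j _.
  by rewrite mxE mulr0.
have [small|/existsP[i]] := boolP [forall i, `|dot (f i) x| <= e].
  exists (nseq_tuple m.+1 None) => i; rewrite /greedy_decode big1_seq ?subr0.
    by move/forallP: small; apply.
  by move=> o /andP[_ /nseqP[-> _]].
rewrite -ltNge => /greedy_step_decrease; set o := Some _ => xo.
have [|s sP] := IH (x - greedy_step o).
  by apply: (le_trans xo); move: xm; rewrite -natr1; lra.
by exists [tuple of o :: s] => j; rewrite /greedy_decode big_cons opprD addrA.
Qed.

Lemma greedy_coded (dist : 'rV[R]_n -> 'rV[R]_n -> R) (X : set 'rV[R]_n)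
    m (D : R) :
  (forall x, X x -> dot x x <= m%:R * (e ^+ 2 / L)) ->
  (forall x y, X x -> X y ->
     (forall i, `|dot (f i) (x - y)| <= 2 * e) -> dist x y <= D) ->
  coded dist X ((#|I| * 2).+1 ^ m) D.
Proof.
move=> Xm distD.
have /choice[c cP] : forall x, exists s : m.-tuple (option (I * bool)),
    X x -> forall i, `|dot (f i) (x - greedy_decode s)| <= e.
  move=> x; have [Xx|nXx] := pselect (X x); last by exists (nseq_tuple m None).
  by have [s sP] := greedy_approx (Xm x Xx); exists s.
have -> : ((#|I| * 2).+1 ^ m)%N = #|[set: m.-tuple (option (I * bool))]%SET|.
  by rewrite cardsT card_tuple card_option card_prod card_bool.
apply: (@coded_finset _ _ _ _ _ _ c) => [x _|x y Xx Xy cxy].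
  by rewrite inE.
apply: distD => // i.
have -> : x - y = (x - greedy_decode (c x)) - (y - greedy_decode (c y)).
  by rewrite cxy opprB addrA subrK.
rewrite dotBr; apply: (le_trans (ler_normB _ _)).
by have := cP x Xx i; have := cP y Xy i; lra.
Qed.

End Greedy.

Section Truncation.
Variables (R : realType) (n : nat).
Implicit Types (x y : 'rV[R]_n) (K : nat).

Lemma sum_exprV2_le K : \sum_(k < K) (2^-1 : R) ^+ k <= 2.
Proof.
have := @geometric_le_lim R K 1 2^-1 ler01; rewrite seriesEord/=.
under eq_bigr do rewrite mul1r.
rewrite ger0_norm ?invr_ge0// (_ : 1 - 2^-1 = 2^-1) ?invrK ?mul1r; last by lra.
by apply; lra.
Qed.

Definition short_codes K : {set {ffun 'I_n -> bool * 'I_K.+1}} :=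
  [set g : {ffun 'I_n -> bool * 'I_K.+1} | (\sum_i (g i).2 <= K)%N]%SET.

(* Weighting a code g by 2^(-sum_i (g i).2) makes the total weight of all codes
   a product over the coordinates. *)
Lemma card_short_codes K : (#|short_codes K| <= 2 ^ (K + 2 * n))%N.
Proof.
rewrite -(ler_nat R) -sum1_card natr_sum natrX exprD exprM.
pose weight (u : bool * 'I_K.+1) : R := 2^-1 ^+ u.2.
have weight_ge0 u : 0 <= weight u by rewrite exprn_ge0// invr_ge0.
apply: (@le_trans _ _ (2 ^+ K *
    \sum_(g : {ffun 'I_n -> _}) \prod_i weight (g i))).
  rewrite mulr_sumr [leRHS](bigID (mem (short_codes K)))/= -[leLHS]addr0 lerD//.
    apply: ler_sum => g; rewrite inE => gK.
    rewrite /weight prodrXr exprVn ler_pdivlMr ?exprn_gt0// mul1r.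
    by rewrite ler_eXn2l// ltr1n.
  by apply: sumr_ge0 => g _; rewrite mulr_ge0 ?exprn_ge0 ?prodr_ge0.
rewrite ler_wpM2l ?exprn_ge0// -(bigA_distr_bigA (fun _ u => weight u))/=.
rewrite prodr_const card_ord lerXn2r ?nnegrE ?sumr_ge0 ?exprn_ge0//.
rewrite -(pair_bigA _ (fun b a => weight (b, a)))/= big_bool/= /weight/=.
rewrite expr2 mulr2n.
by have := sum_exprV2_le K.+1; lra.
Qed.

Lemma norm_sub_le_truncn (delta a b : R) : 0 < delta -> (a < 0) = (b < 0) ->
  Num.truncn (`|a| / delta) = Num.truncn (`|b| / delta) -> `|a - b| <= delta.
Proof.
move=> delta_gt0 sgn_ab trunc_ab.
have trunc_bounds (c : R) : (Num.truncn (`|c| / delta))%:R * delta <= `|c| <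
    (Num.truncn (`|c| / delta))%:R * delta + delta.
  have /truncn_itv : 0 <= `|c| / delta by rewrite divr_ge0// ltW.
  by rewrite -natr1 ler_pdivlMr// ltr_pdivrMr// mulrDl mul1r.
move: sgn_ab (trunc_bounds a) (trunc_bounds b); rewrite trunc_ab ler_norml.
move=> + /andP[+ +] /andP[].
case: (ger0P a) => a0; case: (ger0P b) => b0 //; lra.
Qed.

Lemma truncation_coded (dist : 'rV[R]_n -> 'rV[R]_n -> R) (X : set 'rV[R]_n)
    K (delta D : R) : 0 < delta ->
  (forall x, X x -> \sum_i `|x 0 i| <= K%:R * delta) ->
  (forall x y, X x -> X y ->
     (forall i, `|x 0 i - y 0 i| <= delta) -> dist x y <= D) ->
  coded dist X (2 ^ (K + 2 * n)) D.
Proof.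
move=> delta_gt0 XK distD.
pose t x i := Num.truncn (`|x 0 i| / delta).
have sum_t x : X x -> (\sum_i t x i <= K)%N.
  move=> /XK xK; rewrite -(ler_nat R) natr_sum -(ler_pM2r delta_gt0) mulr_suml.
  apply: le_trans xK; apply: ler_sum => i _.
  by rewrite -ler_pdivlMr// truncn_le// divr_ge0// ltW.
pose c x : {ffun 'I_n -> bool * 'I_K.+1} :=
  [ffun i => (x 0 i < 0, inord (t x i))].
have cE x i : X x -> ((c x i).2 = t x i :> nat).
  move=> /sum_t tK; rewrite ffunE inordK// ltnS (leq_trans _ tK)//.
  by rewrite (bigD1 i)//= leq_addr.
apply: coded_le (card_short_codes K) (lexx D) _.
apply: (@coded_finset _ _ _ _ _ _ c) => [x Xx|x y Xx Xy cxy].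
  by rewrite inE (eq_bigr (t x)) ?sum_t// => i _; exact: cE.
apply: distD => // i; have cxyi : c x i = c y i by rewrite cxy.
apply: norm_sub_le_truncn => //; first by move: cxyi; rewrite !ffunE => -[].
by rewrite -/(t x i) -/(t y i) -!cE// cxy.
Qed.

End Truncation.

Lemma mul_le_half_sqrD (R : realFieldType) (z s t B : R) :
  `|z| <= B -> z * (s * t) <= B * ((s ^+ 2 + t ^+ 2) / 2).
Proof.
rewrite ler_norml => /andP[zl zr].
have : 0 <= (B - z) * (s + t) ^+ 2 by rewrite mulr_ge0 ?sqr_ge0; lra.
have : 0 <= (B + z) * (s - t) ^+ 2 by rewrite mulr_ge0 ?sqr_ge0; lra.
lra.
Qed.

Lemma sin_mul_sum_cos (R : realType) (t : R) (n : nat) :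
  2 * sin t * \sum_(m < n) cos (m%:R * (2 * t)) =
  sin (n%:R * (2 * t) - t) + sin t.
Proof.
elim: n => [|n IH]; first by rewrite big_ord0 mulr0 mul0r sub0r sinN addNr.
rewrite big_ord_recr/= mulrDr IH.
have -> : n.+1%:R * (2 * t) - t = n%:R * (2 * t) + t by rewrite -natr1; ring.
by rewrite sinB sinD; ring.
Qed.

Lemma sum_pair_bool (V : nmodType) (I : finType) (F : I * bool -> V) :
  \sum_h F h = \sum_i (F (i, false) + F (i, true)).
Proof.
transitivity (\sum_i \sum_b F (i, b)).
  by rewrite pair_bigA; apply: eq_bigr => -[].
by apply: eq_bigr => i _; rewrite big_bool addrC.
Qed.

Section Fourier.
Variables (R : realType) (N : nat).
Implicit Types (x y w : nat -> R) (m : 'I_N) (h : 'I_N * bool).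

Definition angle (m c : nat) : R := m%:R * (2 * pi * c%:R / N%:R).

Lemma angleD m a b : angle m (a + b) = angle m a + angle m b.
Proof. by rewrite /angle natrD; ring. Qed.

Lemma angleB m a b : (b <= a)%N -> angle m (a - b) = angle m a - angle m b.
Proof. by move=> ba; rewrite /angle natrB//; ring. Qed.

Lemma sum_cos_angle a : (a < N)%N ->
  \sum_(m < N) cos (angle m a) = N%:R * (a == 0)%:R.
Proof.
case: a => [_|a aN].
  under eq_bigr do rewrite /angle mulr0 mul0r mulr0 cos0.
  by rewrite sumr_const card_ord mulr1.
have N_gt0 : (0 : R) < N%:R by rewrite ltr0n (leq_trans _ aN).
pose t : R := pi * a.+1%:R / N%:R; rewrite mulr0.
have sin_t : 0 < sin t.
  apply: sin_gt0_pi; rewrite /t divr_gt0 ?mulr_gt0 ?pi_gt0//=.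
  by rewrite ltr_pdivrMr// ltr_pM2l ?pi_gt0// ltr_nat.
have := sin_mul_sum_cos t N.
have -> : N%:R * (2 * t) - t = - t + pi *+ 2 *+ a.+1.
  have -> : pi *+ 2 *+ a.+1 = pi * 2 * a.+1%:R :> R by rewrite !mulr_natr.
  by rewrite /t; field; rewrite gt_eqF.
rewrite (periodicn (@sinD2pi R)) sinN addNr => /eqP.
rewrite !mulf_eq0 pnatr_eq0 (gt_eqF sin_t)/= => /eqP sum0.
by rewrite -[RHS]sum0; apply: eq_bigr => m _; rewrite /angle /t -!mulrA.
Qed.

Definition wave h (c : nat) : R := (if h.2 then sin else cos) (angle h.1 c).

Lemma sqr_wave_le1 h c : wave h c ^+ 2 <= 1.
Proof.
rewrite /wave; set t := angle _ _; have := cos2Dsin2 t.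
by have := sqr_ge0 (cos t); have := sqr_ge0 (sin t); case: h.2; lra.
Qed.

Lemma wave_orthogonal a b : (a < N)%N -> (b < N)%N ->
  \sum_h wave h a * wave h b = N%:R * (a == b)%:R.
Proof.
move=> aN bN; wlog ba : a b aN bN / (b <= a)%N => [wl|].
  case/orP: (leq_total a b) => [ab|]; last exact: wl.
  by rewrite eq_sym -wl//; apply: eq_bigr => h _; rewrite mulrC.
rewrite sum_pair_bool /wave/=.
under eq_bigr do rewrite -cosB -angleB//.
rewrite sum_cos_angle ?(leq_ltn_trans (leq_subr _ _))//.
by rewrite subn_eq0 eqn_leq ba andbT.
Qed.

Definition fourier x n h : R := \sum_(c < n) x c * wave h c.

Lemma fourier_inversion x n c : (n <= N)%N -> (c < n)%N ->
  \sum_h fourier x n h * wave h c = N%:R * x c.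
Proof.
move=> nN cn; under eq_bigr do rewrite mulr_suml.
rewrite exchange_big/= (bigD1 (Ordinal cn))//=.
rewrite [X in _ + X]big1 ?addr0 => [|a ac].
  under eq_bigr do rewrite -mulrA.
  by rewrite -mulr_sumr wave_orthogonal ?(leq_trans cn)// eqxx mulr1 mulrC.
under eq_bigr do rewrite -mulrA.
rewrite -mulr_sumr wave_orthogonal ?(leq_trans _ nN)//.
by rewrite -[c]/(nat_of_ord (Ordinal cn)) (inj_eq val_inj) (negPf ac) !mulr0.
Qed.

Lemma parseval x n : (n <= N)%N ->
  \sum_h fourier x n h ^+ 2 = N%:R * \sum_(c < n) x c ^+ 2.
Proof.
move=> nN; under eq_bigr do rewrite expr2 {2}/fourier mulr_sumr.
rewrite exchange_big/= mulr_sumr; apply: eq_bigr => c _.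
under eq_bigr do rewrite mulrCA.
by rewrite -mulr_sumr fourier_inversion// mulrCA.
Qed.

Lemma wave_convolution_cos y w a b m :
  \sum_(i < a) \sum_(k < b) y i * w k * wave (m, false) (i + k) =
  fourier y a (m, false) * fourier w b (m, false) -
  fourier y a (m, true) * fourier w b (m, true).
Proof.
rewrite /fourier !mulr_suml -sumrB; apply: eq_bigr => i _.
rewrite !mulr_sumr -sumrB; apply: eq_bigr => k _.
by rewrite /wave/= angleD cosD; ring.
Qed.

Lemma wave_convolution_sin y w a b m :
  \sum_(i < a) \sum_(k < b) y i * w k * wave (m, true) (i + k) =
  fourier y a (m, true) * fourier w b (m, false) +
  fourier y a (m, false) * fourier w b (m, true).
Proof.
rewrite /fourier !mulr_suml -big_split; apply: eq_bigr => i _.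
rewrite !mulr_sumr -big_split; apply: eq_bigr => k _.
by rewrite /wave/= angleD sinD; ring.
Qed.

Definition correlation w b y a x : R :=
  \sum_(i < a) \sum_(k < b) y i * w k * x (i + k)%N.

Lemma correlation_fourier w b y a x : (a + b <= N.+1)%N ->
  N%:R * correlation w b y a x =
  \sum_h fourier x N h * \sum_(i < a) \sum_(k < b) y i * w k * wave h (i + k).
Proof.
move=> abN; rewrite mulr_sumr [RHS](_ : _ = \sum_h \sum_(i < a) \sum_(k < b)
    fourier x N h * (y i * w k * wave h (i + k))); last first.
  apply: eq_bigr => h _; rewrite mulr_sumr.
  by apply: eq_bigr => i _; rewrite mulr_sumr.
rewrite exchange_big/=; apply: eq_bigr => i _.
rewrite exchange_big/= mulr_sumr; apply: eq_bigr => k _.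
have ikN : (i + k < N)%N by have := ltn_ord i; have := ltn_ord k; lia.
under eq_bigr do rewrite mulrCA.
by rewrite -mulr_sumr fourier_inversion// mulrCA.
Qed.

Lemma correlation_le w b y a x (B : R) :
  (0 < N)%N -> (a <= N)%N -> (b <= N)%N -> (a + b <= N.+1)%N ->
  (forall h, `|fourier w b h| <= B) ->
  correlation w b y a x <= B * (\sum_(c < N) x c ^+ 2 + \sum_(i < a) y i ^+ 2).
Proof.
rewrite -(ltr0n R) => N_gt0 aN bN abN wB.
rewrite -(ler_pM2l N_gt0) correlation_fourier// mulrCA mulrDr -!parseval//.
rewrite -big_split mulr_sumr !sum_pair_bool; apply: ler_sum => m _ /=.
rewrite wave_convolution_cos wave_convolution_sin.
have wc := wB (m, false); have ws := wB (m, true).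
have wsN : `|- fourier w b (m, true)| <= B by rewrite normrN.
move: (fourier x _ (m, false)) (fourier x _ (m, true)) => xc xs.
move: (fourier y _ (m, false)) (fourier y _ (m, true)) => yc ys.
have := mul_le_half_sqrD xc yc wc; have := mul_le_half_sqrD xs ys wc.
have := mul_le_half_sqrD xs yc ws; have := mul_le_half_sqrD xc ys wsN.
lra.
Qed.

End Fourier.

Lemma correlation_widen (R : realType) (w y x : nat -> R) (b n m : nat) :
  (n <= m)%N -> (forall i, (n <= i)%N -> y i = 0) ->
  correlation w b y n x = correlation w b y m x.
Proof.
move=> nm y0; rewrite /correlation -(subnKC nm) big_split_ord/=.
rewrite [X in _ + X]big1 ?addr0// => i _; apply: big1 => k _.
by rewrite y0 ?leq_addr// !mul0r.
Qed.

(* A group of T consecutive rows only meets 2T block columns, and every block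
   column is met by two groups. *)
Lemma grouped_correlation_le (R : realType) (T G : nat) (w y x : nat -> R)
    (B : R) :
  (0 < T)%N -> (forall h : 'I_(2 * T) * bool, `|fourier w T h| <= B) ->
  correlation w T y (G * T) x <=
  B * (\sum_(c < G * T) x c ^+ 2 + \sum_(c < G.+1 * T) x c ^+ 2 +
       \sum_(i < G * T) y i ^+ 2).
Proof.
move=> T_gt0 wB; elim: G => [|G IH].
  rewrite /correlation !mul0n !big_ord0 add0r addr0 mulr_ge0//.
    have T2 : (0 < 2 * T)%N by rewrite muln_gt0.
    exact: le_trans (wB (Ordinal T2, false)).
  by apply: sumr_ge0 => c _; exact: sqr_ge0.
pose y' i := y (G * T + i)%N; pose x' c := x (G * T + c)%N.
have group_le : correlation w T y' T x' <=
    B * (\sum_(c < 2 * T) x' c ^+ 2 + \sum_(i < T) y' i ^+ 2).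
  by apply: correlation_le => //; lia.
have -> : (G.+2 * T = G * T + 2 * T)%N by lia.
move: IH group_le; rewrite mulSnr /correlation !big_split_ord/=.
under [X in _ -> X <= _ -> _]eq_bigr do under eq_bigr do rewrite /x' addnA.
lra.
Qed.

Lemma divnMDl_small p j c : (j < p)%N -> ((c * p + j) %/ p = c)%N.
Proof.
by move=> jp; rewrite divnMDl ?(leq_ltn_trans _ jp)// divn_small// addn0.
Qed.

Lemma modnMDl_small p j c : (j < p)%N -> ((c * p + j) %% p = j)%N.
Proof. by move=> jp; rewrite modnMDl modn_small. Qed.

Section NatIndexedSums.
Variable V : nmodType.
Implicit Types F : nat -> V.

Lemma sum_ord_mul F n p :
  \sum_(q < n * p) F q = \sum_(c < n) \sum_(j < p) F (c * p + j)%N.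
Proof.
elim: n => [|n IH]; first by rewrite !big_ord0.
by rewrite mulSnr big_split_ord/= IH big_ord_recr.
Qed.

Lemma sum_ord_window F i m n : (i + m <= n)%N ->
  \sum_(c < n) (if (i <= c < i + m)%N then F c else 0) =
  \sum_(k < m) F (i + k)%N.
Proof.
move=> imn; rewrite -(subnKC imn) -addnA !big_split_ord/=.
rewrite big1 ?add0r => [|c _]; last by rewrite leqNgt ltn_ord.
rewrite [X in _ + X]big1 ?addr0 => [|c _]; last first.
  by rewrite addnA ltnNge leq_addr andbF.
by apply: eq_bigr => k _; rewrite leq_addr ltn_add2l ltn_ord.
Qed.

End NatIndexedSums.

Section OperatorNorm.
Variables (R : realType) (m n : nat).
Implicit Types (A : 'M[R]_(m, n)) (x : 'cV[R]_n) (y : 'rV[R]_m).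

Lemma opnorm_le A (B : R) :
  (forall x, enorm x^T <= 1 -> enorm (A *m x)^T <= B) -> opnorm A <= B.
Proof.
move=> AB; apply: ge_sup => [|_ [x /= x1 <-]]; last exact: AB.
by exists (enorm (A *m 0)^T), 0 => //=; rewrite trmx0 enorm0.
Qed.

Lemma opnorm0 : opnorm (0 : 'M[R]_(m, n)) = 0.
Proof.
rewrite /opnorm -[RHS]sup1; congr sup; apply/seteqP; split=> [_ [x _ <-]|_ ->].
  by rewrite mul0mx trmx0 enorm0.
by exists 0; rewrite /= ?mul0mx trmx0 enorm0.
Qed.

Lemma opnorm_le_form A (a b : R) : 0 < a -> 0 <= b ->
  (forall x y, dot y (A *m x)^T <= a * dot y y + b * dot x^T x^T) ->
  opnorm A <= 2 * Num.sqrt (a * b).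
Proof.
move=> a0 b0 Aab; apply: opnorm_le => x x1.
rewrite (_ : 2 * _ = Num.sqrt (2 ^+ 2 * (a * b))); last first.
  by rewrite [RHS]sqrtrM// sqrtr_sqr ger0_norm.
rewrite enormE ler_wsqrtr//; set z := (A *m x)^T.
have xx1 : dot x^T x^T <= 1 by rewrite -sqr_enorm expr_le1// enorm_ge0.
have bxx : b * dot x^T x^T <= b by rewrite ler_piMr.
have := Aab x ((2 * a)^-1 *: z); rewrite -/z !dotZl dotZr => form_le.
have zz_le : dot z z / (4 * a) <= b.
  have -> : dot z z / (4 * a) =
      (2 * a)^-1 * dot z z - a * ((2 * a)^-1 * ((2 * a)^-1 * dot z z)).
    by field; rewrite gt_eqF.
  by lra.
by move: zz_le; rewrite ler_pdivrMr ?mulr_gt0//; lra.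
Qed.

End OperatorNorm.

Section ZeroExtension.
Variables (R : realType) (n : nat).
Implicit Types u v : 'rV[R]_n.

Lemma vat_ord u (i : 'I_n) : vat u i = u 0 i.
Proof. by rewrite /vat valK. Qed.

Lemma vat_lt u k (kn : (k < n)%N) : vat u k = u 0 (Ordinal kn).
Proof. by rewrite -vat_ord. Qed.

Lemma vat_oversize u k : (n <= k)%N -> vat u k = 0.
Proof. by move=> nk; rewrite /vat insubF// ltnNge nk. Qed.

Lemma dot_vat u v : dot u v = \sum_(k < n) vat u k * vat v k.
Proof. by apply: eq_bigr => i _; rewrite !vat_ord. Qed.

Lemma sum_vat_sqr_le u m : \sum_(k < m) vat u k ^+ 2 <= dot u u.
Proof.
rewrite dot_vat; under [leRHS]eq_bigr do rewrite -expr2.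
move: (vat u) (@vat_oversize u) => s s_oversize.
have [mn|/ltnW nm] := leqP m n.
  rewrite -(subnKC mn) big_split_ord/= lerDl.
  by apply: sumr_ge0 => k _; exact: sqr_ge0.
rewrite -(subnKC nm) big_split_ord/= [X in _ + X]big1 ?addr0// => k _.
by rewrite s_oversize ?leq_addr// expr0n.
Qed.

Variable p : nat.

Definition coord u (j c : nat) : R := vat u (c * p + j).

Lemma sum_coord_sqr_le u m :
  \sum_(j < p) \sum_(c < m) coord u j c ^+ 2 <= dot u u.
Proof.
rewrite exchange_big -(sum_ord_mul (fun q => vat u q ^+ 2)).
exact: sum_vat_sqr_le.
Qed.

Lemma sum_shifted_coord_sqr_le u k m :
  \sum_(j < p) \sum_(c < m) coord u j (c + k) ^+ 2 <= dot u u.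
Proof.
apply: le_trans (sum_coord_sqr_le u (k + m)); apply: ler_sum => j _.
rewrite big_split_ord/=; under eq_bigr do rewrite addnC.
by rewrite lerDr; apply: sumr_ge0 => c _; exact: sqr_ge0.
Qed.

End ZeroExtension.

Section Toeplitz.
Variables (R : realType) (T p nR : nat).
Implicit Types (u v : 'rV[R]_(T * p)) (x : 'cV[R]_((nR + T - 1) * p)).
Implicit Types (h : 'I_(2 * T) * bool) (j : 'I_p).

Lemma toepnorm0 : toepnorm nR (0 : 'rV[R]_(T * p)) = 0.
Proof.
rewrite /toepnorm (_ : Toep nR 0 = 0) ?opnorm0//.
apply/matrixP => i q; rewrite !mxE/=; case: ifP => // _.
by rewrite /vat; case: insub => //= k; rewrite mxE.
Qed.

(* Coordinate j of v_(T-k), the block on the k-th superdiagonal of Toep v. *)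
Definition superdiag v (j k : nat) : R := coord p v j (T - k.+1).

Lemma dot_superdiag u v :
  dot u v = \sum_(j < p) \sum_(k < T) superdiag u j k * superdiag v j k.
Proof.
rewrite exchange_big/= dot_vat (sum_ord_mul (fun q => vat u q * vat v q)).
by rewrite (reindex_inj rev_ord_inj).
Qed.

Lemma Toep_mul v x (i : 'I_nR) : (Toep nR v *m x) i 0 =
  \sum_(j < p) \sum_(k < T) superdiag v j k * coord p x^T j (i + k).
Proof.
rewrite mxE.
pose entry (c j : nat) :=
  if (i <= c < i + T)%N then superdiag v j (c - i) else 0.
transitivity (\sum_(q < (nR + T - 1) * p)
    entry (q %/ p)%N (q %% p)%N * vat x^T q).
  apply: eq_bigr => q _; rewrite vat_ord !mxE /entry /superdiag /coord.
  by rewrite -subnDA add1n.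
rewrite (sum_ord_mul (fun q => entry (q %/ p)%N (q %% p)%N * vat x^T q)).
rewrite [RHS]exchange_big/=.
pose col c := \sum_(j < p) superdiag v j (c - i) * coord p x^T j c.
transitivity (\sum_(c < nR + T - 1) if (i <= c < i + T)%N then col c else 0).
  apply: eq_bigr => c _; rewrite /col; case: ifP => ic.
    apply: eq_bigr => j _.
    by rewrite divnMDl_small// modnMDl_small// /entry ic.
  by apply: big1 => j _; rewrite divnMDl_small// /entry ic mul0r.
rewrite sum_ord_window; last by have := ltn_ord i; lia.
by apply: eq_bigr => k _; apply: eq_bigr => j _; rewrite addKn.
Qed.

Lemma dot_Toep_mul v x (y : 'rV[R]_nR) : dot y (Toep nR v *m x)^T =
  \sum_(j < p) correlation (superdiag v j) T (vat y) nR (coord p x^T j).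
Proof.
rewrite /correlation exchange_big/=; apply: eq_bigr => i _.
rewrite mxE Toep_mul mulr_sumr; apply: eq_bigr => j _; rewrite mulr_sumr.
by apply: eq_bigr => k _; rewrite vat_ord mulrA.
Qed.

Lemma sqr_Toep_mul_le v x (i : 'I_nR) : (Toep nR v *m x) i 0 ^+ 2 <=
  dot v v * \sum_(k < T) \sum_(j < p) coord p x^T j (i + k) ^+ 2.
Proof.
rewrite Toep_mul dot_superdiag [X in _ <= _ * X]exchange_big/= !pair_bigA.
exact: sum_mul_sqr_le.
Qed.

Lemma toepnorm_le_enorm v : toepnorm nR v <= Num.sqrt T%:R * enorm v.
Proof.
apply: opnorm_le => x x1; rewrite !enormE -sqrtrM// ler_wsqrtr//.
apply: (@le_trans _ _ (dot v v * \sum_(i < nR) \sum_(k < T) \sum_(j < p)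
    coord p x^T j (i + k) ^+ 2)).
  rewrite mulr_sumr; apply: ler_sum => i _; rewrite mxE -expr2.
  exact: sqr_Toep_mul_le.
rewrite [leRHS]mulrC ler_wpM2l ?dotxx_ge0// exchange_big/=.
rewrite -[T in leRHS]card_ord -sumr_const.
apply: ler_sum => k _; rewrite exchange_big/=.
apply: le_trans (sum_shifted_coord_sqr_le p x^T k nR) _.
by rewrite -sqr_enorm expr_le1// enorm_ge0.
Qed.

Lemma toepnorm_le_fourier v (B : R) : (0 < T)%N -> (0 < p)%N -> 0 < B ->
  (forall h j, `|fourier (superdiag v j) T h| <= B) ->
  toepnorm nR v <= 3 * Num.sqrt p%:R * B.
Proof.
move=> T_gt0 p_gt0 B0 vB; have p0 : (0 : R) < p%:R by rewrite ltr0n.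
apply: (@le_trans _ _ (2 * Num.sqrt ((B * p%:R) * (2 * B)))); last first.
  rewrite -ler_sqr ?nnegrE ?mulr_ge0 ?(ltW B0)// !exprMn.
  rewrite !sqr_sqrtr ?mulr_ge0 ?(ltW B0)//.
  have : 0 <= p%:R * B ^+ 2 by rewrite mulr_ge0// sqr_ge0.
  lra.
apply: opnorm_le_form; rewrite ?mulr_gt0 ?mulr_ge0 ?(ltW B0)// => x y.
have nRT : (nR <= nR * T)%N by rewrite leq_pmulr.
pose rows := \sum_(i < nR * T) vat y i ^+ 2.
pose cols j n := \sum_(c < n) coord p x^T j c ^+ 2.
apply: (@le_trans _ _ (\sum_(j < p)
    B * (cols j (nR * T)%N + cols j (nR.+1 * T)%N + rows))).
  rewrite dot_Toep_mul; apply: ler_sum => j _.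
  rewrite (correlation_widen _ _ _ nRT); last exact: vat_oversize.
  by apply: grouped_correlation_le => // h; exact: vB.
rewrite -mulr_sumr !big_split/= sumr_const card_ord -[rows *+ p]mulr_natl.
rewrite -mulrA -[2 * B]mulrC -!mulrA -mulrDr ler_wpM2l ?(ltW B0)//.
have rows_le : p%:R * rows <= p%:R * dot y y.
  by rewrite ler_pM2l// sum_vat_sqr_le.
have := sum_coord_sqr_le p x^T (nR * T).
have := sum_coord_sqr_le p x^T (nR.+1 * T).
rewrite /cols; lra.
Qed.

Definition wave_row (hj : ('I_(2 * T) * bool) * 'I_p) : 'rV[R]_(T * p) :=
  \row_q if (q %% p == hj.2)%N then wave R hj.1 (T - (q %/ p).+1) else 0.

Lemma superdiag_wave_row hj j (k : 'I_T) :
  superdiag (wave_row hj) j k = if j == hj.2 then wave R hj.1 k else 0.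
Proof.
have kT := ltn_ord k; have jp := ltn_ord j.
have qTp : ((T - k.+1) * p + j < T * p)%N.
  by rewrite -[X in (_ < X * _)%N](subnK kT) mulnDl ltn_add2l mulSn ltn_addr.
rewrite /superdiag /coord (vat_lt _ qTp) mxE/=.
by rewrite modnMDl_small// divnMDl_small// subnSK// subKn// ltnW.
Qed.

Lemma dot_wave_row hj v :
  dot (wave_row hj) v = fourier (superdiag v hj.2) T hj.1.
Proof.
rewrite dot_superdiag (bigD1 hj.2)//= [X in _ + X]big1 ?addr0 => [|j jneq].
  by apply: eq_bigr => k _; rewrite superdiag_wave_row eqxx mulrC.
by apply: big1 => k _; rewrite superdiag_wave_row (negPf jneq) mul0r.
Qed.

Lemma dotxx_wave_row_le hj : dot (wave_row hj) (wave_row hj) <= T%:R.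
Proof.
rewrite dot_wave_row -[T in leRHS]card_ord -sumr_const; apply: ler_sum => k _.
by rewrite superdiag_wave_row eqxx -expr2 sqr_wave_le1.
Qed.

End Toeplitz.

Lemma up_logM_le p m n : (1 < p)%N ->
  (up_log p (m * n) <= up_log p m + up_log p n)%N.
Proof.
by move=> p1; apply: up_log_min => //; rewrite expnD leq_mul ?up_logP.
Qed.

Lemma expn_up_log_le p n : (1 < p)%N -> (0 < n)%N ->
  (p ^ up_log p n <= p * n)%N.
Proof.
case: n => [//|[|n]] p1 _; first by rewrite up_log1 muln1 ltnW.
have up_gt0 : (0 < up_log p n.+2)%N by rewrite up_log_gt0 p1.
by rewrite -(prednK up_gt0) expnS leq_mul2l ltnW ?orbT// up_log_gtn.
Qed.

Section UpLog2.
Variable R : realType.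
Local Notation sqrt2 := (Num.sqrt (2 : R)).

Lemma sqrt2X_up_log4_bounds n : (0 < n)%N ->
  2 * Num.sqrt n%:R <= sqrt2 ^+ up_log 2 (4 * n) <= 3 * Num.sqrt n%:R.
Proof.
move=> n_gt0; have n4_gt0 : (0 < 4 * n)%N by rewrite muln_gt0.
have sqrt4n : Num.sqrt (4 * n)%:R = 2 * Num.sqrt (n%:R : R).
  by rewrite natrM sqrtrM// (_ : 4%:R = 2 ^+ 2) ?sqrtr_sqr ?ger0_norm//; ring.
rewrite -sqrt4n -sqrtr_pow2 ler_wsqrtr/=; last first.
  by rewrite -natrX ler_nat up_logP.
apply: (@le_trans _ _ (sqrt2 * Num.sqrt (4 * n)%:R)).
  by rewrite -sqrtrM// ler_wsqrtr// -natrX -natrM ler_nat expn_up_log_le.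
by rewrite sqrt4n mulrA ler_wpM2r//; have /andP[_] := sqrt2_bounds R; lra.
Qed.

Lemma ln2_ge_half : 2^-1 <= ln (2 : R).
Proof.
have : ln (1 + - 2^-1) <= - 2^-1 :> R by apply: le_ln1Dx; lra.
by rewrite (_ : 1 + - 2^-1 = 2^-1) ?lnV ?posrE//; lra.
Qed.

Lemma ln_expR1M (x : R) : 0 < x -> ln (expR 1 * x) = 1 + ln x.
Proof. by move=> x0; rewrite lnM ?posrE ?expR_gt0// expRK. Qed.

Lemma ln_expR1M_ge1 n : (0 < n)%N -> 1 <= ln (expR 1 * n%:R : R).
Proof. by move=> n_gt0; rewrite ln_expR1M ?ltr0n// lerDl ln_ge0// ler1n. Qed.

Lemma up_log2_le_ln n : (0 < n)%N ->
  (up_log 2 n)%:R <= 2 * ln (expR 1 * n%:R : R) - 1.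
Proof.
move=> n_gt0; have lnn_ge0 : 0 <= ln (n%:R : R) by rewrite ln_ge0// ler1n.
have : ln (2 ^+ up_log 2 n : R) <= ln (2 * n%:R).
  rewrite ler_ln ?posrE ?exprn_gt0 ?mulr_gt0 ?ltr0n//.
  by rewrite -natrX -natrM ler_nat expn_up_log_le.
rewrite ln_expR1M ?ltr0n// lnXn// [ln (2 * _)]lnM ?posrE ?ltr0n//.
rewrite -[_ *+ up_log _ _]mulr_natr.
case: (up_log 2 n) => [|k] => [_|]; first by lra.
by rewrite -[k.+1%:R]natr1; have := ler_wpM2l (ler0n R k) ln2_ge_half; lra.
Qed.

End UpLog2.

Section SphereCodes.
Variables (R : realType) (T p nR : nat).
Hypotheses (T_gt0 : (0 < T)%N) (p_gt0 : (0 < p)%N).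
Local Notation d := (T * p)%N.
Local Notation sqrt2 := (Num.sqrt (2 : R)).
Local Notation dist := (fun x y : 'rV[R]_d => toepnorm nR (x - y)).
Local Notation X := (@sphere R d).

Let d_gt0 : (0 < d)%N. Proof. by rewrite muln_gt0 T_gt0. Qed.

Lemma sphere_dist_le x y : X x -> X y -> dist x y <= 2 * Num.sqrt T%:R.
Proof.
move=> x1 y1; apply: le_trans (toepnorm_le_enorm _ _) _.
by rewrite mulrC ler_wpM2r// enorm_sub_le2.
Qed.

Lemma sphere_truncation_coded K : (0 < K)%N ->
  coded dist X (2 ^ (K + 2 * d)) (Num.sqrt T%:R * (d%:R / K%:R)).
Proof.
move=> K_gt0; have K0 : (0 : R) < K%:R by rewrite ltr0n.
have sqrtd_gt0 : 0 < Num.sqrt (d%:R : R) by rewrite sqrtr_gt0 ltr0n.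
apply: (@truncation_coded _ _ _ _ _ (Num.sqrt d%:R / K%:R)).
- by rewrite divr_gt0.
- move=> x x1; rewrite mulrC divfK ?gt_eqF//.
  by apply: le_trans (sum_norm_le x) _; rewrite x1 mulr1.
- move=> x y _ _ xy; apply: le_trans (toepnorm_le_enorm _ _) _.
  rewrite ler_wpM2l// -[in leRHS](@sqr_sqrtr _ d%:R)// expr2 -mulrA.
  by apply: enorm_le_coord => i; rewrite !mxE.
Qed.

Lemma sphere_truncation_coded_pow2 n : (4 * d <= 2 ^ n)%N ->
  coded dist X (2 ^ (2 ^ n)) (2 * d%:R * Num.sqrt T%:R / 2 ^+ n).
Proof.
case: n => [|n] dn; first by move: d_gt0 dn; lia.
apply: coded_le (sphere_truncation_coded (expn_gt0 2 n)).
  by rewrite leq_exp2l//; move: dn; rewrite expnS; lia.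
rewrite exprS natrX le_eqVlt; apply/orP; left; apply/eqP.
by field; rewrite expf_neq0.
Qed.

Lemma sphere_greedy_coded m : (0 < m)%N ->
  coded dist X ((8 * d).+1 ^ m) (6 * Num.sqrt (d%:R / m%:R)).
Proof.
move=> m_gt0; have [m0 T0] : (0 : R) < m%:R /\ (0 : R) < T%:R by rewrite !ltr0n.
pose e : R := Num.sqrt (T%:R / m%:R).
have e0 : 0 < e by rewrite sqrtr_gt0 divr_gt0.
have e2 : e ^+ 2 = T%:R / m%:R by rewrite sqr_sqrtr// divr_ge0// ltW.
have -> : (8 * d = #|{: 'I_(2 * T) * bool * 'I_p}| * 2)%N.
  by rewrite !card_prod !card_ord card_bool; lia.
apply: (@greedy_coded _ _ _ (@wave_row R T p) T%:R e) => //.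
- exact: dotxx_wave_row_le.
- move=> x x1; rewrite -sqr_enorm x1 expr1n e2.
  by rewrite (_ : _ * _ = 1)//; field; rewrite !gt_eqF.
- move=> x y _ _ xy.
  have -> : 6 * Num.sqrt (d%:R / m%:R) = 3 * Num.sqrt p%:R * (2 * e).
    by rewrite natrM mulrAC [in LHS]mulrC sqrtrM// -/e; ring.
  apply: toepnorm_le_fourier; rewrite ?mulr_gt0// => h j.
  by rewrite -(dot_wave_row (h, j)).
Qed.

(* With 2^n bits at l bits per greedy step there is room for 2^n / l steps. *)
Lemma sphere_greedy_coded_pow2 n l : (8 * d < 2 ^ l)%N ->
  coded dist X (2 ^ (2 ^ n)) (12 * Num.sqrt (d%:R * l%:R) / sqrt2 ^+ n).
Proof.
move=> dl; have l_gt0 : (0 < l)%N by case: l dl => //; lia.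
rewrite -mulrA -sqrtr_pow2 -sqrtrV ?exprn_ge0// -sqrtrM ?mulr_ge0//.
have n0 : (0 : R) < 2 ^+ n by rewrite exprn_gt0.
have [nl|ln] := ltnP (2 ^ n)%N l.
  apply: coded_const => [|x y Xx Xy]; first by rewrite expn_gt0.
  apply: le_trans (sphere_dist_le Xx Xy) _.
  rewrite ler_pM// ?ler_nat// ler_wsqrtr//.
  by rewrite ler_pdivlMr// -natrX -!natrM ler_nat leq_mul ?leq_pmulr// ltnW.
pose m := (2 ^ n %/ l)%N; have m_gt0 : (0 < m)%N by rewrite divn_gt0.
apply: coded_le (sphere_greedy_coded m_gt0).
  apply: (@leq_trans ((2 ^ l) ^ m)); first by rewrite leq_exp2r.
  by rewrite -expnM leq_exp2l// mulnC leq_divM.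
have nml : (2 ^ n <= 4 * (l * m))%N.
  by have := ltn_ceil (2 ^ n) l_gt0; rewrite -/m; move: m_gt0; nia.
rewrite [12](_ : _ = 6 * Num.sqrt (2 ^+ 2)); last first.
  by rewrite sqrtr_sqr ger0_norm//; ring.
rewrite -mulrA ler_wpM2l// -sqrtrM ?exprn_ge0// ler_wsqrtr//.
rewrite [leRHS]mulrA ler_pdivlMr// mulrAC ler_pdivrMr ?ltr0n//.
rewrite -!natrX -!natrM ler_nat; nia.
Qed.

Lemma gamma2_sphere_le n0 n1 l :
  (0 < n0 <= n1)%N -> (4 * d <= 2 ^ n1)%N -> (8 * d < 2 ^ l)%N ->
  (gamma2 dist X <= (8 * Num.sqrt T%:R * sqrt2 ^+ n0 +
    12 * (n1 - n0)%:R * Num.sqrt (d%:R * l%:R) +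
    8 * d%:R * Num.sqrt T%:R / sqrt2 ^+ n1)%:E)%E.
Proof.
move=> n01 dn1 dl.
have -> : 8 * Num.sqrt T%:R * sqrt2 ^+ n0 +
    12 * (n1 - n0)%:R * Num.sqrt (d%:R * l%:R) +
    8 * d%:R * Num.sqrt T%:R / sqrt2 ^+ n1 =
  4 * (2 * Num.sqrt T%:R) * sqrt2 ^+ n0 +
    (n1 - n0)%:R * (12 * Num.sqrt (d%:R * l%:R)) +
    4 * (2 * d%:R * Num.sqrt T%:R) / sqrt2 ^+ n1 by ring.
apply: gamma2_le_three_ranges => //; rewrite ?mulr_ge0//.
- by move=> x; rewrite subrr toepnorm0.
- exact: sphere_dist_le.
- by move=> n _; exact: sphere_greedy_coded_pow2.
- move=> n n1n; apply: sphere_truncation_coded_pow2.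
  by rewrite (leq_trans dn1)// leq_exp2l.
Qed.

Lemma gamma2_sphere_le_sqrt :
  (gamma2 dist X <= (28 * (Num.sqrt T%:R * Num.sqrt d%:R))%:E)%E.
Proof.
pose n := up_log 2 (4 * d).
have n_gt0 : (0 < n <= n)%N by rewrite up_log_gt0 leqnn; lia.
apply: le_trans
  (gamma2_sphere_le n_gt0 (up_logP _ _) (ltn_expl (8 * d) _)) _ => //.
rewrite lee_fin subnn mulr0 mul0r addr0.
have := sqrt2X_up_log4_bounds R d_gt0; rewrite -/n => /andP[s_ge s_le].
have tail_le : d%:R / sqrt2 ^+ n <= Num.sqrt d%:R / 2.
  rewrite ler_pdivrMr ?sqrt2X_gt0// -[leLHS]sqr_sqrtr//.
  by have := ler_wpM2l (sqrtr_ge0 d%:R) s_ge; lra.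
have := ler_wpM2l (sqrtr_ge0 T%:R) s_le.
by have := ler_wpM2l (sqrtr_ge0 T%:R) tail_le; lra.
Qed.

Lemma gamma2_sphere_le_up_log :
  (gamma2 dist X <= (28 * Num.sqrt d%:R + 12 * (up_log 2 (T * T))%:R *
    Num.sqrt (d%:R * (up_log 2 (16 * d))%:R))%:E)%E.
Proof.
pose n0 := up_log 2 (4 * p); pose n1 := up_log 2 (4 * (d * T)).
have dT_gt0 : (0 < d * T)%N by rewrite muln_gt0 d_gt0.
have dTE : (4 * (d * T) = 4 * p * (T * T))%N by lia.
have n01 : (0 < n0 <= n1)%N.
  by rewrite up_log_gt0 /n1 dTE leq_up_log ?leq_pmulr ?muln_gt0 ?T_gt0//; lia.
have dn1 : (4 * d <= 2 ^ n1)%N.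
  by rewrite (leq_trans _ (up_logP _ _))// leq_mul2l leq_pmulr.
have dl : (8 * d < 2 ^ up_log 2 (16 * d))%N.
  by rewrite (leq_trans _ (up_logP _ _))//; lia.
apply: le_trans (gamma2_sphere_le n01 dn1 dl) _; rewrite lee_fin.
have := sqrt2X_up_log4_bounds R p_gt0; rewrite -/n0 => /andP[_ s0_le].
have := sqrt2X_up_log4_bounds R dT_gt0; rewrite -/n1 => /andP[s1_ge _].
have sqrtdE : Num.sqrt d%:R = Num.sqrt T%:R * Num.sqrt p%:R :> R.
  by rewrite natrM sqrtrM.
have head_le : 8 * Num.sqrt T%:R * sqrt2 ^+ n0 <= 24 * Num.sqrt d%:R.
  by rewrite sqrtdE; have := ler_wpM2l (sqrtr_ge0 T%:R) s0_le; lra.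
have tail_le : 8 * d%:R * Num.sqrt T%:R / sqrt2 ^+ n1 <= 4 * Num.sqrt d%:R.
  rewrite ler_pdivrMr ?sqrt2X_gt0// -{1}[d%:R]sqr_sqrtr//.
  have := ler_wpM2l (sqrtr_ge0 d%:R) s1_ge.
  by rewrite [(d * T)%:R]natrM sqrtrM//; lra.
have range_le : 12 * (n1 - n0)%:R * Num.sqrt (d%:R * (up_log 2 (16 * d))%:R) <=
    12 * (up_log 2 (T * T))%:R * Num.sqrt (d%:R * (up_log 2 (16 * d))%:R) :> R.
  rewrite ler_wpM2r// ler_wpM2l// ler_nat leq_subLR /n1 dTE.
  exact: up_logM_le.
lra.
Qed.

End SphereCodes.

Lemma gamma2_sphere_le_ln (R : realType) (T p nR : nat) :
  (0 < T)%N -> (0 < p)%N ->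
  (gamma2 (fun x y : 'rV[R]_(T * p) => toepnorm nR (x - y))
     (@sphere R (T * p)) <=
    (172 * (Num.sqrt (T * p)%:R *
      (ln (expR 1 * (T * p)%:R) * ln (expR 1 * T%:R))))%:E)%E.
Proof.
move=> T_gt0 p_gt0; have d_gt0 : (0 < T * p)%N by rewrite muln_gt0 T_gt0.
have := ln_expR1M_ge1 R T_gt0; have := up_log2_le_ln R T_gt0.
have := ln_expR1M_ge1 R d_gt0; have := up_log2_le_ln R d_gt0.
set ld := ln (_ * (T * p)%:R); set lT := ln (_ * T%:R).
move=> up_log_d_le ld_ge1 up_log_T_le lT_ge1.
apply: le_trans (gamma2_sphere_le_up_log R nR T_gt0 p_gt0) _; rewrite lee_fin.
have levels_le : (up_log 2 (T * T))%:R <= 4 * lT.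
  apply: (@le_trans _ _ (up_log 2 T + up_log 2 T)%:R).
    by rewrite ler_nat up_logM_le.
  by rewrite natrD; lra.
have bits_le : (up_log 2 (16 * (T * p)))%:R <= 5 * ld.
  have : (up_log 2 (2 ^ 4 * (T * p)) <= 4 + up_log 2 (T * p))%N.
    by rewrite -[4%N in leqRHS](@up_expnK 2)// up_logM_le.
  by rewrite -(ler_nat R) natrD; lra.
have sqrt_bits_le : Num.sqrt (up_log 2 (16 * (T * p)))%:R <= 3 * ld.
  rewrite -[leRHS]ger0_norm -?sqrtr_sqr ?ler_wsqrtr//; last by lra.
  by apply: le_trans bits_le _; nra.
have product_le :
    (up_log 2 (T * T))%:R * Num.sqrt (up_log 2 (16 * (T * p)))%:R <=
    4 * lT * (3 * ld) by rewrite ler_pM.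
rewrite sqrtrM//; have sqrtd_ge0 := sqrtr_ge0 ((T * p)%:R : R).
have factor_ge1 : 1 <= ld * lT by nra.
have := ler_wpM2l sqrtd_ge0 product_le; have := ler_wpM2l sqrtd_ge0 factor_ge1.
lra.
Qed.

Theorem proposition7 (R : realType) :
  exists C : R, 0 < C /\
  forall T p nR : nat, (1 <= T)%N -> (1 <= p)%N -> (1 <= nR)%N ->
    (gamma2 (fun x y : 'rV[R]_(T * p) => toepnorm nR (x - y)%R) (@sphere R (T * p))
      <= ((C * Num.sqrt (T%:R * @ptilde R T p))%R)%:E)%E.
Proof.
exists 172; split=> // T p nR T_gt0 p_gt0 _.
rewrite /ptilde mulrA -natrM [Num.sqrt _]sqrtrM//.
case: (leP T%:R) => _.
  apply: le_trans (gamma2_sphere_le_sqrt R nR T_gt0 p_gt0) _.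
  by rewrite lee_fin [Num.sqrt T%:R * _]mulrC ler_wpM2r// ?mulr_ge0// ler_nat.
apply: le_trans (gamma2_sphere_le_ln R nR T_gt0 p_gt0) _.
rewrite -exprMn sqrtr_sqr ger0_norm// mulr_ge0// (le_trans ler01)//.
  by rewrite ln_expR1M_ge1// muln_gt0 T_gt0.
exact: ln_expR1M_ge1.
Qed.
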